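(* Let $\omega_1,\omega_2$ be linearly independent one-forms (an orthonormal coframe of the metric $ds^2=\omega_1^2+\omega_2^2$) on a smooth surface $M$, with associated connection form $\omega_{12}$, and let $A>0$ be a smooth function on $M$. Let $\omega_{12}^*$ be the connection form associated to the coframe $$\omega_1^*=A\,\omega_1,\qquad \omega_2^*=A\,\omega_2 .$$ Then $$\omega_{12}^*=\omega_{12}+*\,d\log A .$$
   Context: Connection form: for linearly independent one-forms $\eta_1,\eta_2$ on a surface, the associated connection form $\eta_{12}$ is the unique one-form with $d\eta_1=\eta_{12}\wedge\eta_2$, $d\eta_2=\eta_1\wedge\eta_{12}$. The Hodge operator $*$ is the function-linear operator on one-forms with $*\omega_1=\omega_2$, $*\omega_2=-\omega_1$. *)

(* Defs.v *)
From mathcomp Require Import all_boot all_order all_algebra.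
From mathcomp Require Import all_classical all_reals all_analysis.
Import Order.TTheory GRing.Theory Num.Theory.
Import numFieldNormedType.Exports.

Set Implicit Arguments.
Unset Strict Implicit.
Unset Printing Implicit Defensive.

Local Open Scope classical_set_scope.
Local Open Scope ring_scope.

Definition partial {R : realType} (j : 'I_2) (f : 'rV[R]_2 -> R) :
    'rV[R]_2 -> R :=
  fun x => 'D_(delta_mx 0 j) f x.

(* For U open: f is of class C^oo on U iff [Ck k U f] for all k.  At a fixed
   k.+1 the condition is C^k plus differentiability of the k-th order partial
   derivatives together with continuity of those of order k.+1. *)
Fixpoint Ck {R : realType} (k : nat) (U : set 'rV[R]_2) (f : 'rV[R]_2 -> R) :
    Prop :=
  match k with
  | 0%N => forall x, U x -> {for x, continuous f}
  | k'.+1 => (forall x, U x -> differentiable f x) /\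
             (forall j, Ck k' U (partial j f))
  end.

Definition smooth_on {R : realType} (U : set 'rV[R]_2) (f : 'rV[R]_2 -> R) :=
  forall k, Ck k U f.

(* A chart is a homeomorphism from an open set of M onto an open set of R^2.
   [coord] and [param] are total functions that are only meaningful on [dom]
   and on [coord @` dom] respectively. *)
Record chart (R : realType) (M : topologicalType) := Chart {
  dom : set M;
  coord : M -> 'rV[R]_2;
  param : 'rV[R]_2 -> M;
  dom_open : open dom;
  codom_open : open (coord @` dom);
  coordK : forall p, dom p -> param (coord p) = p;
  coord_cts : forall p, dom p -> {for p, continuous coord};
  param_cts : forall x, (coord @` dom) x -> {for x, continuous param}
}.

Definition codom {R : realType} {M : topologicalType} (c : chart R M) :
    set 'rV[R]_2 :=
  coord c @` dom c.

(* Entry i of the coordinates of the chart c', read in the chart c. *)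
Definition transition {R : realType} {M : topologicalType} (c c' : chart R M)
    (i : 'I_2) : 'rV[R]_2 -> R :=
  fun x => coord c' (param c x) 0 i.

Record smoothSurface (R : realType) := SmoothSurface {
  carrier :> topologicalType;
  surface_hausdorff : hausdorff_space carrier;
  surface_second_countable : @second_countable carrier;
  atlas_index : Type;
  atlas : atlas_index -> chart R carrier;
  atlas_cover : forall p : carrier, exists c, dom (atlas c) p;
  atlas_smooth : forall c c' i,
    smooth_on (coord (atlas c) @` (dom (atlas c) `&` dom (atlas c')))
              (transition (atlas c) (atlas c') i)
}.

Section Forms.
Context {R : realType} {M : smoothSurface R}.
Local Notation index := (@atlas_index R M).

Definition smooth_function (f : M -> R) :=
  forall c : index, smooth_on (codom (atlas c)) (f \o param (atlas c)).

(* [w c p] is the row of coefficients of the covector w_p in the basis dx^0,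
   dx^1 of the chart c; its value is only meaningful when p lies in [dom c]. *)
Definition covector_field := index -> M -> 'rV[R]_2.

Definition covector_eq (v w : covector_field) :=
  forall c p, dom (atlas c) p -> v c p = w c p.

Definition coef (w : covector_field) (c : index) (j : 'I_2) : 'rV[R]_2 -> R :=
  fun x => w c (param (atlas c) x) 0 j.

(* The first condition is the transformation law of covectors under a change
   of chart. *)
Definition one_form (w : covector_field) :=
  (forall c c' p j, dom (atlas c) p -> dom (atlas c') p ->
     w c p 0 j = \sum_(i < 2) w c' p 0 i *
       partial j (transition (atlas c) (atlas c') i) (coord (atlas c) p)) /\
  (forall c j, smooth_on (codom (atlas c)) (coef w c j)).

Definition add_form (v w : covector_field) : covector_field :=
  fun c p => v c p + w c p.

Definition scale_form (f : M -> R) (w : covector_field) : covector_field :=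
  fun c p => f p *: w c p.

Definition differential (f : M -> R) : covector_field :=
  fun c p => \row_j partial j (f \o param (atlas c)) (coord (atlas c) p).

(* A 2-form is given in each chart by its coefficient on dx^0 /\ dx^1. *)
Definition two_field := index -> M -> R.

Definition two_field_eq (s t : two_field) :=
  forall c p, dom (atlas c) p -> s c p = t c p.

Definition wedge (v w : covector_field) : two_field :=
  fun c p => v c p 0 0 * w c p 0 1 - v c p 0 1 * w c p 0 0.

Definition ext_d (w : covector_field) : two_field :=
  fun c p => partial 0 (coef w c 1) (coord (atlas c) p)
           - partial 1 (coef w c 0) (coord (atlas c) p).

Definition frame_mx (v w : covector_field) (c : index) (p : M) : 'M[R]_2 :=
  col_mx (v c p) (w c p).

Definition lin_independent (v w : covector_field) :=
  forall c p, dom (atlas c) p -> row_free (frame_mx v w c p).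

(* When e1, e2 are linearly independent, the two structure equations determine
   the components of e12 pointwise, hence e12 is unique up to covector_eq. *)
Definition is_connection_form (e1 e2 e12 : covector_field) :=
  [/\ one_form e12,
      two_field_eq (ext_d e1) (wedge e12 e2) &
      two_field_eq (ext_d e2) (wedge e1 e12)].

(* The product with the inverse matrix is the row (a, b) of components of t in
   the coframe, t = a w1 + b w2, so that the result is a w2 - b w1. *)
Definition hodge (w1 w2 t : covector_field) : covector_field :=
  fun c p => t c p *m invmx (frame_mx w1 w2 c p)
                   *m (col_mx (w2 c p) (- w1 c p) : 'M[R]_2).

Lemma hodge_linear (w1 w2 t u : covector_field) (f : M -> R) :
  covector_eq (hodge w1 w2 (add_form (scale_form f t) u))
    (add_form (scale_form f (hodge w1 w2 t)) (hodge w1 w2 u)).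
Proof.
by move=> c p _; rewrite /hodge /add_form /scale_form !mulmxDl -!scalemxAl.
Qed.

Lemma hodge_coframe (w1 w2 : covector_field) : lin_independent w1 w2 ->
  covector_eq (hodge w1 w2 w1) w2 /\
  covector_eq (hodge w1 w2 w2) (scale_form (fun=> (-1)%R) w1).
Proof.
move=> w12; split=> c p /w12; rewrite row_free_unit /hodge => F.
- have -> : w1 c p = (row_mx 1%:M 0 : 'M[R]_(1, 1 + 1)) *m frame_mx w1 w2 c p.
    by rewrite [RHS](@mul_row_col _ 1 1 1) mul1mx mul0mx addr0.
  by rewrite (mulmxK F) [LHS](@mul_row_col _ 1 1 1) mul1mx mul0mx addr0.
- have -> : w2 c p = (row_mx 0 1%:M : 'M[R]_(1, 1 + 1)) *m frame_mx w1 w2 c p.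
    by rewrite [RHS](@mul_row_col _ 1 1 1) mul1mx mul0mx add0r.
  rewrite (mulmxK F) [LHS](@mul_row_col _ 1 1 1) mul1mx mul0mx add0r.
  by rewrite /scale_form scaleN1r.
Qed.

End Forms.

Arguments covector_field {R} M.

(* Main.v *)
(** Pointwise, a one-form is determined by its wedge products with the two
    members of a coframe.  By the Leibniz rule
    [d(A w_i) = dA /\ w_i + A dw_i], so after division by [A] the structure
    equations of both coframes give
    [w12s /\ w2 = w12 /\ w2 + dlog A /\ w1] and
    [w1 /\ w12s = w1 /\ w12 + dlog A /\ w2].  Writing
    [dlog A = a w1 + b w2], the form [w12 + (a w2 - b w1)] has the same two
    wedge products. *)

Require Import Defs.
From mathcomp Require Import all_boot all_order all_algebra.
From mathcomp Require Import all_classical all_reals all_analysis.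
From mathcomp Require Import ring.
Import Order.TTheory GRing.Theory Num.Theory.
Import numFieldNormedType.Exports.
Local Open Scope ring_scope.

Lemma partialM {R : realType} (j : 'I_2) (f g : 'rV[R]_2 -> R) x :
  differentiable f x -> differentiable g x ->
  partial j (f * g) x = f x * partial j g x + g x * partial j f x.
Proof. by move=> df dg; rewrite /partial deriveM//; exact: diff_derivable. Qed.

Lemma partial_ln {R : realType} (j : 'I_2) (f : 'rV[R]_2 -> R) x :
  differentiable f x -> 0 < f x ->
  partial j (ln (R:=R) \o f) x = (f x)^-1 * partial j f x.
Proof.
move=> df f0; have dln := is_derive1_ln f0.
have diffln : differentiable (ln (R:=R)) (f x).
  by apply/derivable1_diffP; exact: ex_derive.
rewrite /partial !deriveE//; last exact: differentiable_comp.
by rewrite diff_comp//= diff1E// derive1E derive_val /GRing.scale/= mulrC.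
Qed.

Lemma det_mx2 {R : comPzRingType} (B : 'M[R]_2) :
  \det B = B 0 0 * B 1 1 - B 0 1 * B 1 0.
Proof.
rewrite (expand_det_row _ 0) !big_ord_recl big_ord0 /cofactor !det_mx11 !mxE.
have -> : lift 0 0 = 1 :> 'I_2 by exact: val_inj.
have -> : lift 1 0 = 0 :> 'I_2 by exact: val_inj.
by rewrite expr0 expr1 mul1r addr0 mulN1r mulrN.
Qed.

Section Pointwise.
Context {R : realType} {M : smoothSurface R}.
Implicit Types (v w t : covector_field M) (f : M -> R).

(** Order 1 of [Ck] is the lowest whose first clause is differentiability. *)
Lemma smooth_function_differentiable {f c p} :
  smooth_function f -> dom (atlas c) p ->
  differentiable (f \o param (atlas c)) (Defs.coord (atlas c) p).
Proof. by move=> hf cp; apply: (hf c 1%N).1; exists p. Qed.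

Lemma one_form_coef_differentiable {w c p} j :
  one_form w -> dom (atlas c) p ->
  differentiable (coef w c j) (Defs.coord (atlas c) p).
Proof. by move=> [_ hw] cp; apply: (hw c j 1%N).1; exists p. Qed.

(** Product rule on each chart coefficient: the terms that differentiate [f] assemble into the wedge
    product, the others into [f p * ext_d w c p]. *)
Lemma ext_d_scale f w c p :
  smooth_function f -> one_form w -> dom (atlas c) p ->
  ext_d (scale_form f w) c p =
    wedge (differential f) w c p + f p * ext_d w c p.
Proof.
move=> hf hw cp.
have coef_scale j : coef (scale_form f w) c j
    = (f \o param (atlas c)) * coef w c j.
  by apply/funext => x; rewrite /coef /scale_form mxE.
have df := smooth_function_differentiable hf cp.
have dw j := one_form_coef_differentiable j hw cp.
rewrite /ext_d /wedge !coef_scale !partialM// !mxE /coef/= coordK//.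
by ring.
Qed.

Lemma differential_ln f c p :
  smooth_function f -> (forall q, 0 < f q) -> dom (atlas c) p ->
  differential (fun q => ln (f q)) c p = (f p)^-1 *: differential f c p.
Proof.
move=> hf f0 cp; apply/rowP => j; rewrite !mxE.
rewrite (partial_ln j (f \o param (atlas c))) ?f0//= ?coordK//.
exact: smooth_function_differentiable.
Qed.

(** The wedge coefficient is the determinant of the frame matrix. *)
Lemma wedge_neq0 {v w c p} :
  row_free (frame_mx v w c p) -> wedge v w c p != 0.
Proof.
have F0 k : frame_mx v w c p 0 k = v c p 0 k.
  by rewrite -(col_mxEu (v c p) (w c p)); congr (_ _ _); exact: val_inj.
have F1 k : frame_mx v w c p 1 k = w c p 0 k.
  by rewrite -(col_mxEd (v c p) (w c p)); congr (_ _ _); exact: val_inj.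
by rewrite row_free_unit unitmxE unitfE det_mx2 !F0 !F1.
Qed.

Lemma wedge_frame_inj v w t u c p :
  row_free (frame_mx v w c p) ->
  wedge t w c p = wedge u w c p -> wedge v t c p = wedge v u c p ->
  t c p = u c p.
Proof.
move=> /wedge_neq0 D0 tw vt; apply/rowP => j; apply: (mulIf D0).
(* Cramer's rule for the components of [s] in the frame [v], [w], with the denominator cleared. *)
have expand (s : covector_field M) : s c p 0 j * wedge v w c p =
    v c p 0 j * wedge s w c p + w c p 0 j * wedge v s c p.
  rewrite /wedge; case: j => -[|[|//]] lt_j2.
  - by rewrite (_ : Ordinal _ = 0); [ring|exact: val_inj].
  - by rewrite (_ : Ordinal _ = 1); [ring|exact: val_inj].
by rewrite !expand tw vt.
Qed.

(** The witnesses are the entries of [t] times the inverse frame matrix: multiplying that row by the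
    frame gives back [t], and by the stacked rows [w], [- v] gives [hodge]. *)
Lemma hodge_components v w t c p :
  row_free (frame_mx v w c p) ->
  exists a b, t c p = a *: v c p + b *: w c p /\
              hodge v w t c p = a *: w c p - b *: v c p.
Proof.
rewrite row_free_unit => F.
pose u : 'M[R]_(1, 1 + 1) := t c p *m invmx (frame_mx v w c p).
have uE (s : 'M[R]_(1, 1 + 1)) (x y : 'rV[R]_2) :
    s *m (col_mx x y : 'M[R]_(1 + 1, 2)) = s 0 0 *: x + s 0 1 *: y.
  rewrite -[s in LHS]hsubmxK mul_row_col.
  rewrite [lsubmx s]mx11_scalar [rsubmx s]mx11_scalar !mul_scalar_mx !mxE.
  by congr (s _ _ *: _ + s _ _ *: _); exact: val_inj.
exists (u 0 0), (u 0 1); split; last by rewrite /hodge uE scalerN.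
by rewrite -uE mulmxKV.
Qed.

End Pointwise.

Theorem theorem4p1 (R : realType) (M : smoothSurface R)
    (w1 w2 w12 w12s : covector_field M) (A : M -> R)
    (hw1 : one_form w1) (hw2 : one_form w2)
    (hind : lin_independent w1 w2)
    (hw12 : is_connection_form w1 w2 w12)
    (hA : smooth_function A) (hApos : forall p, 0 < A p)
    (hw12s : is_connection_form (scale_form A w1) (scale_form A w2) w12s) :
  covector_eq w12s
    (add_form w12 (hodge w1 w2 (differential (fun p => ln (A p))))).
Proof.
move=> c p cp; have F := hind c p cp.
have A0 : A p != 0 by rewrite gt_eqF.
case: hw12 => _ /(_ c p cp) dw1 /(_ c p cp) dw2.
case: hw12s => _ /(_ c p cp) + /(_ c p cp).
rewrite !ext_d_scale// dw1 dw2.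
have [a [b [dlnE hodgeE]]] :=
  hodge_components w1 w2 (differential (fun p => ln (A p))) c p F.
(* The formula for [dlog A] is solved for [dA], so that no inverse of [A p] is left for [ring]. *)
have dA : differential A c p = A p *: (a *: w1 c p + b *: w2 c p).
  by rewrite -dlnE differential_ln// scalerA divff// scale1r.
(* Both wedge identities are multiplied by [A p], the factor that the scaled coframe puts into the
   structure equations [ds1] and [ds2]. *)
move=> ds1 ds2; apply: (wedge_frame_inj w1 w2) => //; apply: (mulfI A0).
- move: ds1; rewrite /wedge /add_form hodgeE dA /scale_form !mxE => ds1.
  (* The middle term is the right-hand side of [ds1], verbatim, so that it can be rewritten
     backwards. *)
  transitivity (w12s c p 0 0 * (A p * w2 c p 0 1)
    - w12s c p 0 1 * (A p * w2 c p 0 0)); first by ring.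
  by rewrite -ds1; ring.
- move: ds2; rewrite /wedge /add_form hodgeE dA /scale_form !mxE => ds2.
  transitivity (A p * w1 c p 0 0 * w12s c p 0 1
    - A p * w1 c p 0 1 * w12s c p 0 0); first by ring.
  by rewrite -ds2; ring.
Qed.
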